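(* For every $N\in\mathbb{N}$ and every integer $k\ge2$, the distribution of the random integer $I_N^{(k)}=\prod_{j=1}^N p_j^{X^{(k)}_{p_j}}$ is $P_N^{(k)}$.
   Context: $\{p_j\}_{j=1}^\infty$ denotes the primes in increasing order. $\Omega_N=\{n\in\mathbb{N}: p_j\nmid n \text{ for all } j>N\}$. $C_N=\sum_{n\in\Omega_N}\frac1n<\infty$, and $P_N$ is the probability measure on $\Omega_N$ given by $P_N(\{n\})=\frac1{C_N}\frac1n$, $n\in\Omega_N$. For $k\ge2$, $S_k$ denotes the set of $k$-free positive integers, i.e. those $n$ with $p^k\nmid n$ for all primes $p$, and $P_N^{(k)}(\cdot)=P_N(\,\cdot\,|S_k)$ is the measure $P_N$ conditioned on $S_k$ (that is, on $\Omega_N^{(k)}=\Omega_N\cap S_k$). The random variables $X_{p_j}$ are independent with the Geom$(1-\frac1{p_j})$ distribution: $P(X_{p_j}=m)=(\frac1{p_j})^m(1-\frac1{p_j})$, $m=0,1,2,\ldots$. The random variables $\{X^{(k)}_{p_j}\}_{j=1}^\infty$ are independent, with $X^{(k)}_{p_j}$ distributed as $X_{p_j}$ conditioned on $\{X_{p_j}<k\}$. *)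

(* Defs.v *)
From HB Require Import structures.
From mathcomp Require Import all_boot all_order all_algebra finmap.
From mathcomp Require Import all_classical all_reals all_analysis.
Set Implicit Arguments.
Unset Strict Implicit.
Unset Printing Implicit Defensive.
Import Order.TTheory GRing.Theory Num.Theory.
Local Open Scope classical_set_scope.
Local Open Scope ring_scope.

Lemma ex_prime_gt (n : nat) : exists p, (n < p)%N && prime p.
Proof. by have [p np pp] := prime_above n; exists p; rewrite np pp. Qed.

Definition next_prime (n : nat) : nat := ex_minn (ex_prime_gt n).

(* Indices start at 0: nth_prime j is the prime usually written p_(j+1). *)
Definition nth_prime (j : nat) : nat := iter j.+1 next_prime 0%N.

Lemma prime_nth_prime (j : nat) : prime (nth_prime j).
Proof. by rewrite /nth_prime iterS /next_prime; case: ex_minnP => p /andP[]. Qed.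

Lemma nth_primeS (j : nat) : (nth_prime j < nth_prime j.+1)%N.
Proof.
by rewrite /nth_prime [X in (_ < X)%N]iterS {2}/next_prime; case: ex_minnP => p /andP[].
Qed.

Lemma nth_prime_surj (p : nat) : prime p -> exists j, nth_prime j = p.
Proof.
move=> pp.
have lt_j j : (j < nth_prime j)%N.
  by elim: j => [|j IH]; [exact: prime_gt0 (prime_nth_prime 0)
                         |exact: leq_ltn_trans IH (nth_primeS j)].
have exj : exists j, (p <= nth_prime j)%N by exists p; exact: ltnW.
case: (ex_minnP exj) => j pj minj; exists j; apply/eqP; rewrite eqn_leq pj andbT.
rewrite /nth_prime iterS /next_prime; case: ex_minnP => q _; apply; rewrite pp andbT.
case: j pj minj => [|j] pj minj; first exact: prime_gt0.
by rewrite ltnNge; apply/negP => /minj; rewrite ltnn.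
Qed.

(* Omega_N: the index condition is the 0-based form of "p_j does not divide n
   for all j > N". *)
Definition smooth_numbers (N : nat) : set nat :=
  [set n | (0 < n)%N /\ forall j, (N <= j)%N -> ~~ (nth_prime j %| n)%N].

Definition k_free (k : nat) : set nat :=
  [set n | (0 < n)%N /\ forall p, prime p -> ~~ (p ^ k %| n)%N].

Section laws.
Context {R : realType}.
Local Open Scope ereal_scope.

Definition harmonic_mass (N : nat) : \bar R :=
  \esum_(n in smooth_numbers N) (n%:R^-1)%:E.

(* P_N, as a law on nat carried by Omega_N. *)
Definition harmonic_prob (N : nat) (A : set nat) : \bar R :=
  \esum_(n in A `&` smooth_numbers N) ((harmonic_mass N)^-1 * (n%:R^-1)%:E).

(* Number of failures before the first success of probability q. *)
Definition geometric_prob (q : R) (A : set nat) : \bar R :=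
  \esum_(m in A) ((1 - q) ^+ m * q)%:E.

(* A |-> mu (A | B) *)
Definition conditioned {T : Type} (mu : set T -> \bar R) (B A : set T) : \bar R :=
  mu (A `&` B) / mu B.

End laws.

Definition mutually_independent {d d'} {T : measurableType d}
    {T' : measurableType d'} {R : realType} {P : probability T R}
    {I : choiceType} (X : I -> {RV P >-> T'}) : Prop :=
  forall (J : {fset I}) (A : I -> set T'), (forall i, measurable (A i)) ->
    P (\bigcap_(i in [set` J]) (X i @^-1` A i)) =
    (\prod_(i <- J) P (X i @^-1` A i))%E.

Section random_integer.
Context {d} {T : measurableType d} {R : realType} {P : probability T R}.

Definition random_integer (X : nat -> {RV P >-> nat}) (N : nat) (t : T) : nat :=
  (\prod_(j < N) nth_prime j ^ X j t)%N.

Lemma measurable_random_integer (X : nat -> {RV P >-> nat}) (N : nat) :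
  measurable_fun setT (random_integer X N).
Proof.
elim: N => [|N IH].
  have -> : random_integer X 0 = cst 1%N; last exact: measurable_cst.
  by apply/funext => t; rewrite /random_integer big_ord0.
move=> _ Y _; rewrite setTI.
rewrite [Z in measurable Z](_ : _ = \bigcup_a \bigcup_(b in
   [set b | Y (a * nth_prime N ^ b)%N])
   (random_integer X N @^-1` [set a] `&` X N @^-1` [set b])); last first.
  apply/seteqP; split => [t /= Yt|t [a _] [b /= Yab] [/= aE bE]].
    exists (random_integer X N t) => //; exists (X N t) => //=.
    by move: Yt; rewrite /random_integer big_ord_recr.
  by move: Yab; rewrite -aE -bE /random_integer big_ord_recr.
apply: bigcupT_measurable => a; apply: bigcup_measurable => b _.
apply: measurableI; first by rewrite -[Z in measurable Z]setTI; exact: IH.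
exact: measurable_funPTI.
Qed.

HB.instance Definition _ (X : nat -> {RV P >-> nat}) (N : nat) :=
  isMeasurableFun.Build _ _ _ _ (random_integer X N)
    (measurable_random_integer X N).

End random_integer.

(* Main.v *)
Require Import Defs.
From mathcomp Require Import all_boot all_order all_algebra finmap.
From mathcomp Require Import all_classical all_reals all_analysis.
Import Order.TTheory GRing.Theory Num.Theory.
Local Open Scope classical_set_scope.
Local Open Scope ring_scope.

(** Write x_j = 1/p_j. By unique factorization, n = p_1^e_1 ... p_N^e_N is a
bijection from the exponent vectors e in {0, ..., k-1}^N to the k-free integers
in Omega_N ([k_free_smoothP], [prime_product_inj]), and it turns the weight 1/n
into the product of the x_j^e_j ([invr_prime_product]). The conditioned geometric
law gives the exponent m < k the probability x_j^m / Z_j, where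
Z_j = 1 + x_j + ... + x_j^(k-1); the factor 1 - x_j cancels
([conditioned_geometric_prob1]). By independence the vector e has probability
(1/n) / (Z_1 ... Z_N), and expanding the product Z_1 ... Z_N shows that it is the
sum of 1/n over all k-free n in Omega_N ([harmonic_weightT]). Hence the random
integer has the law proportional to 1/n on that finite set.

The conditioned law P_N^(k) is a quotient of sums in which the factor 1/C_N
cancels. This cancellation in the extended reals needs 0 < C_N < +oo
([harmonic_mass_fin]). Finiteness comes from the same bijection: a finite subset of
Omega_N consists of M-free integers as soon as M exceeds all its elements, so its
harmonic sum is at most the product of N truncated geometric series of ratio at
most 1/2, that is at most 2^N. *)

(** * Unique factorization over the first primes *)

Lemma nth_prime_inj : injective nth_prime.
Proof.
have lt_nth : {homo nth_prime : i j / (i < j)%N}.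
  exact: (homo_ltn ltn_trans nth_primeS).
by move=> i j eq_ij; case: (ltngtP i j) => // /lt_nth; rewrite eq_ij ltnn.
Qed.

(** The bound k on the exponents is part of the type, so that the vectors form a
finite type over which sums can be taken. *)
Definition prime_product {N k : nat} (e : {ffun 'I_N -> 'I_k}) : nat :=
  (\prod_(j < N) nth_prime j ^ e j)%N.

Lemma prime_product_gt0 (N k : nat) (e : {ffun 'I_N -> 'I_k}) : (0 < prime_product e)%N.
Proof.
by apply: prodn_gt0 => j; rewrite expn_gt0 prime_gt0// prime_nth_prime.
Qed.

(** Summing over the j equal to i, a condition on naturals, covers at once the
primes that occur in the product and those beyond the first N. *)
Lemma logn_prime_product (N k i : nat) (e : {ffun 'I_N -> 'I_k}) :
  logn (nth_prime i) (prime_product e) =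
  (\sum_(j < N | i == j) e j)%N.
Proof.
suff [] : (0 < prime_product e)%N /\
  logn (nth_prime i) (prime_product e) = (\sum_(j < N | i == j) e j)%N by [].
rewrite [in RHS]big_mkcond /=.
apply: (big_ind2 (fun m s => (0 < m)%N /\ logn (nth_prime i) m = s)).
- by rewrite logn1.
- by move=> m s m' s' [m0 <-] [m'0 <-]; rewrite muln_gt0 m0 m'0 lognM.
- move=> j _; rewrite expn_gt0 prime_gt0 ?prime_nth_prime//; split=> //.
  rewrite lognX logn_prime ?prime_nth_prime// (inj_eq nth_prime_inj).
  by case: eqP; rewrite ?muln1 ?muln0.
Qed.

Lemma logn_prime_product_ord (N k : nat) (i : 'I_N) (e : {ffun 'I_N -> 'I_k}) :
  logn (nth_prime i) (prime_product e) = e i.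
Proof.
by rewrite logn_prime_product (big_pred1 i)// => j; rewrite eq_sym -val_eqE.
Qed.

Lemma logn_prime_product_large (N k i : nat) (e : {ffun 'I_N -> 'I_k}) : (N <= i)%N ->
  logn (nth_prime i) (prime_product e) = 0%N.
Proof.
move=> Ni; rewrite logn_prime_product big_pred0// => j.
by rewrite gtn_eqF// (leq_trans (ltn_ord j)).
Qed.

Lemma prime_product_inj (N k : nat) :
  injective (@prime_product N k).
Proof.
move=> f g eq_fg; apply/ffunP => i; apply: val_inj => /=.
by rewrite -[LHS](logn_prime_product_ord _ _ i f) eq_fg logn_prime_product_ord.
Qed.

(** The exponents of such an n are its valuations at the first N primes: k-freeness
bounds them by k, and smoothness leaves no other prime. Positivity of k matters
because no integer is 0-free, while the empty vector exists when N = 0. *)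
Lemma k_free_smoothP (N k n : nat) : (0 < k)%N ->
  (k_free k `&` smooth_numbers N) n <->
  exists f : {ffun 'I_N -> 'I_k}, prime_product f = n.
Proof.
move=> k0; split=> [[[n0 freen] [_ smoothn]]|[f <-]].
  have lt_k (j : 'I_N) : (logn (nth_prime j) n < k)%N.
    by have := freen _ (prime_nth_prime j); rewrite pfactor_dvdn ?prime_nth_prime// -ltnNge.
  exists [ffun j => Ordinal (lt_k j)].
  apply: eqn_from_log => // [|p]; first exact: prime_product_gt0.
  have [/nth_prime_surj [j <-]|np] := boolP (prime p); last first.
    by rewrite lognE (negPf np) [RHS]lognE (negPf np).
  have [jN|Nj] := ltnP j N.
    by rewrite (logn_prime_product_ord _ _ (Ordinal jN)) ffunE.
  rewrite logn_prime_product_large//; apply/esym/eqP.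
  by rewrite -leqn0 leqNgt logn_gt0 mem_primes n0 prime_nth_prime smoothn.
have gt0 := prime_product_gt0 _ _ f.
split; split=> //; [move=> p pp|move=> j Nj].
  have [j <-] := nth_prime_surj pp.
  rewrite pfactor_dvdn ?prime_nth_prime// -ltnNge.
  have [jN|Nj] := ltnP j N; last by rewrite logn_prime_product_large.
  by rewrite (logn_prime_product_ord _ _ (Ordinal jN)).
by rewrite -[nth_prime j]expn1 pfactor_dvdn ?prime_nth_prime// logn_prime_product_large.
Qed.

(** * Harmonic sums over smooth integers *)

Lemma fsbig_finType (R : Type) (idx : R) (op : Monoid.com_law idx) (I : finType)
    (p : pred I) (F : I -> R) :
  \big[op/idx]_(i \in [set` p]) F i = \big[op/idx]_(i | p i) F i.
Proof.
rewrite -[RHS]big_filter [RHS]fsbig_seq ?filter_uniq ?index_enum_uniq//.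
apply: eq_fsbigl; apply/seteqP; split=> i /=;
  by rewrite mem_filter mem_index_enum andbT.
Qed.

Section sums.
Context {R : realType}.
Implicit Types (x : R) (A : set nat).

Definition harmonic_weight (N k : nat) A : R :=
  \sum_(f : {ffun 'I_N -> 'I_k} | prime_product f \in A) (prime_product f)%:R^-1.

Lemma invr_prime_product (N k : nat) (f : {ffun 'I_N -> 'I_k}) :
  (prime_product f)%:R^-1 = \prod_(j < N) ((nth_prime j)%:R^-1) ^+ f j :> R.
Proof.
by rewrite natr_prod -prodfV; apply: eq_bigr => j _; rewrite natrX exprVn.
Qed.

(** Finite Euler product: distributing the product over the sums yields one term
for each exponent vector. *)
Lemma harmonic_weightT (N k : nat) :
  harmonic_weight N k setT =
  \prod_(j < N) \sum_(i < k) ((nth_prime j)%:R^-1) ^+ i.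
Proof.
rewrite bigA_distr_bigA; apply: eq_big => f; first by rewrite in_setT.
by rewrite invr_prime_product.
Qed.

(** The constant c is 1 when harmonic sums are bounded, and 1/C_N when the sum is a
value of the measure P_N. *)
Lemma esum_k_free_smooth (N k : nat) (c : R) A : (0 < k)%N -> 0 <= c ->
  (\esum_(n in A `&` (k_free k `&` smooth_numbers N)) (c * n%:R^-1)%:E =
   (c * harmonic_weight N k A)%:E)%E.
Proof.
move=> k0 c0.
have -> : A `&` (k_free k `&` smooth_numbers N) =
    @prime_product N k @` [set f | prime_product f \in A].
  apply/seteqP; split=> [n [An /(k_free_smoothP _ _ _ k0) [f fn]]|n [f]].
    by exists f => //=; rewrite fn inE.
  rewrite /= inE => Af <-; split=> //.
  by apply/(k_free_smoothP _ _ _ k0); exists f.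
rewrite esum_image; last by move=> f g _ _; exact: prime_product_inj.
have finS : finite_set [set f | @prime_product N k f \in A].
  exact: finite_finset.
rewrite esum_fset//; last by move=> f _; rewrite lee_fin mulr_ge0 ?invr_ge0.
by rewrite fsumEFin// /harmonic_weight mulr_sumr -fsbig_finType.
Qed.

Lemma sum_expr_gt0 x (k : nat) : 0 <= x -> (0 < k)%N -> 0 < \sum_(i < k) x ^+ i.
Proof.
move=> x0; case: k => // k _; rewrite big_ord_recl expr0 ltr_wpDr//.
by apply: sumr_ge0 => i _; rewrite exprn_ge0.
Qed.

(** The bound 2 is a fixed point of s |-> 1 + s/2, which dominates the passage from
one truncated geometric sum to the next. *)
Lemma sum_expr_le2 x (k : nat) : 0 <= x <= 2^-1 -> \sum_(i < k) x ^+ i <= 2.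
Proof.
move=> /andP[x0 x2]; elim: k => [|k IH]; first by rewrite big_ord0.
rewrite big_ord_recl expr0.
under eq_bigr do rewrite lift0 exprS.
rewrite -mulr_sumr -[leRHS]/(1 + 1) lerD2l.
apply: (@le_trans _ _ (2^-1 * 2)); last by rewrite mulVf.
by apply: ler_pM => //; apply: sumr_ge0 => i _; rewrite exprn_ge0.
Qed.

Lemma invr_prime_bounds (j : nat) : 0 <= ((nth_prime j)%:R^-1 : R) <= 2^-1.
Proof.
have := prime_gt1 (prime_nth_prime j) => p2.
by rewrite invr_ge0 ler0n /= lef_pV2 ?posrE ?ltr0n ?ler_nat// ltnW.
Qed.

(** The lower bound is the term n = 1. For the upper bound, each finite partial sum
is compared with a finite Euler product, at most 2^N whatever its cut-off M. *)
Lemma harmonic_mass_fin (N : nat) :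
  exists2 c : R, 0 < c & harmonic_mass N = c%:E.
Proof.
suff [lo hi] : ((1%:E <= harmonic_mass N :> \bar R) /\
    harmonic_mass N <= (2 ^+ N)%:E :> \bar R)%E.
  case: harmonic_mass lo hi => [c|//|//]; rewrite !lee_fin => c1 _.
  by exists c => //; apply: lt_le_trans c1.
split.
  apply: esum_ge; exists [set 1%N]; last by rewrite fsbig_set1 invr1.
  split=> // _ ->; split=> // j _.
  by rewrite dvdn1 gtn_eqF// prime_gt1// prime_nth_prime.
apply: ge_ereal_sup => _ [F [finF FN] <-].
pose M := (\max_(n <- fset_set F) n).+1.
have FM : F `<=` setT `&` (k_free M `&` smooth_numbers N).
  (* p^M > M > n for every prime p, so p^M cannot divide n. *)
  move=> n Fn; have sn := FN _ Fn; split=> //; split=> //.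
  case: sn => n0 _; split=> // p pp; apply/negP => /(dvdn_leq n0).
  apply/negP; rewrite -ltnNge (ltn_trans _ (ltn_expl M (prime_gt1 pp)))//.
  by rewrite ltnS; apply: leq_bigmax_seq => //; rewrite in_fset_set// inE.
apply: (@le_trans _ _ (harmonic_weight N M setT)%:E).
  rewrite -[harmonic_weight _ _ _]mul1r -esum_k_free_smooth//; apply: esum_ge.
  by exists F => //; under [in leRHS]eq_fsbigr do rewrite mul1r.
rewrite lee_fin harmonic_weightT -[N in leRHS]card_ord -prodr_const.
apply: ler_prod => j _; have := invr_prime_bounds j => xb.
rewrite sum_expr_le2// andbT.
by apply: sumr_ge0 => i _; rewrite exprn_ge0//; case/andP: xb.
Qed.

Lemma harmonic_weightT_gt0 (N k : nat) : (0 < k)%N ->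
  0 < harmonic_weight N k setT.
Proof.
move=> k0; rewrite harmonic_weightT; apply: prodr_gt0 => j _.
by apply: sum_expr_gt0 => //; case/andP: (invr_prime_bounds j).
Qed.

Lemma EFin_div (a b : R) : b != 0 -> (a%:E / b%:E)%E = (a / b)%:E.
Proof. by move=> b0; rewrite inver (negPf b0) EFinM. Qed.

Lemma conditioned_harmonic_prob (N k : nat) A : (0 < k)%N ->
  conditioned (harmonic_prob N) (k_free k) A =
  (harmonic_weight N k A / harmonic_weight N k setT)%:E.
Proof.
move=> k0; have [c c0 massE] := harmonic_mass_fin N.
have probE B : harmonic_prob N (B `&` k_free k) =
    (c^-1 * harmonic_weight N k B)%:E.
  rewrite /harmonic_prob massE inver gt_eqF//.
  under eq_esum do rewrite -EFinM.
  by rewrite -setIA esum_k_free_smooth// invr_ge0 ltW.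
have T0 : harmonic_weight N k setT != 0 by rewrite gt_eqF// harmonic_weightT_gt0.
have c'0 : c^-1 != 0 by rewrite invr_neq0// gt_eqF.
rewrite /conditioned probE -[k_free k]setTI probE EFin_div ?mulf_neq0//.
by rewrite -mulf_div divff// mul1r.
Qed.

(** * Truncated geometric laws *)

Lemma geometric_prob_lt x (k : nat) : 0 <= x <= 1 ->
  geometric_prob (1 - x) [set m | (m < k)%N] =
  ((1 - x) * \sum_(i < k) x ^+ i)%:E.
Proof.
move=> /andP[x0 x1]; rewrite /geometric_prob esum_fset.
- rewrite fsumEFin// -fsbig_ord mulr_sumr; congr (_%:E).
  by apply: eq_bigr => i _; rewrite subKr mulrC.
- exact: finite_II.
- by move=> i _; rewrite lee_fin mulr_ge0 ?subKr ?exprn_ge0 ?subr_ge0.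
Qed.

Lemma conditioned_geometric_prob1 x (k m : nat) : 0 <= x < 1 -> (m < k)%N ->
  conditioned (geometric_prob (1 - x)) [set i | (i < k)%N] [set m] =
  (x ^+ m / \sum_(i < k) x ^+ i)%:E.
Proof.
move=> /andP[x0 x1] mk; rewrite /conditioned geometric_prob_lt ?x0 ?ltW//.
have s0 : \sum_(i < k) x ^+ i != 0.
  by rewrite gt_eqF// sum_expr_gt0//; case: (k) mk.
have y0 : 1 - x != 0 by rewrite gt_eqF// subr_gt0.
rewrite setIidl; last by move=> _ ->.
rewrite /geometric_prob esum_set1; last first.
  by rewrite lee_fin mulr_ge0 ?subKr ?exprn_ge0 ?subr_ge0// ltW.
rewrite EFin_div ?mulf_neq0// subKr; congr (_%:E).
by rewrite invfM mulrA mulfK.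
Qed.

Lemma conditioned_geometric_prob_lt x (k : nat) : 0 <= x < 1 -> (0 < k)%N ->
  conditioned (geometric_prob (1 - x)) [set i | (i < k)%N] [set i | (i < k)%N] =
  1%E.
Proof.
move=> /andP[x0 x1] k0; rewrite /conditioned setIid geometric_prob_lt ?x0 ?ltW//.
have nz : (1 - x) * \sum_(i < k) x ^+ i != 0.
  by rewrite mulf_neq0 ?gt_eqF ?subr_gt0 ?sum_expr_gt0.
by rewrite EFin_div// divff.
Qed.
End sums.

(** * The law of the random integer *)

Section independence.
Context {R : realType} {d} {T : measurableType d} {P : probability T R}.
Context (X : nat -> {RV P >-> nat}) (X_independent : mutually_independent X).

(** Independence is stated for families of sets indexed by all naturals; here the
family is extended by the full space beyond N and the finite set of indices is
{0, ..., N-1}. *)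
Lemma independent_prefix (N : nat) (A : 'I_N -> set nat) :
  P (\bigcap_(j in [set: 'I_N]) (X j @^-1` A j)) = (\prod_(j < N) P (X j @^-1` A j))%E.
Proof.
pose B j := if insub j is Some i then A i else setT.
have BE (i : 'I_N) : B i = A i by rewrite /B valK.
under [RHS]eq_bigr do rewrite -BE.
rewrite -(big_mkord xpredT (fun j => P (X j @^-1` B j))).
rewrite (perm_big [fset j in index_iota 0 N]%fset) /=; last first.
  by apply: uniq_perm; rewrite ?fset_uniq ?iota_uniq// => j; rewrite !inE.
rewrite -X_independent//; congr (P _); apply/seteqP; split=> t XA j.
  rewrite /= !inE mem_index_iota /= => jN.
  by have := XA (Ordinal jN) Logic.I; rewrite -BE.
by move=> _; rewrite -BE; apply: XA; rewrite /= !inE mem_index_iota /=.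
Qed.

Lemma measure_conull_setI (E F : set T) : measurable E -> measurable F ->
  P F = 1%E -> P E = P (E `&` F).
Proof.
move=> mE mF PF.
have -> : P E = (P (E `\` F) + P (E `&` F))%E by exact: measureDI.
suff -> : P (E `\` F) = 0%E by rewrite add0e.
apply/eqP; rewrite eq_le measure_ge0 andbT.
apply: (@le_trans _ _ (P (~` F))).
  by apply: le_measure; rewrite ?inE; [exact: measurableD|exact: measurableC|move=> t []].
by rewrite probability_setC// PF subee.
Qed.

(** The hypothesis makes all exponents smaller than k almost surely. Up to a null
set, the event is then the disjoint union of the cells on which the exponent vector
is constant, and independence computes the probability of each cell. *)
Lemma probability_prime_product (N k : nat) (A : set nat) :
  (forall j, P (X j @^-1` [set m | (m < k)%N]) = 1%E) ->
  P (random_integer X N @^-1` A) =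
  (\sum_(f : {ffun 'I_N -> 'I_k} | prime_product f \in A)
     \prod_(j < N) P (X j @^-1` [set (f j : nat)]))%E.
Proof.
move=> Xk.
pose cell (f : {ffun 'I_N -> 'I_k}) := \bigcap_(j in [set: 'I_N]) (X j @^-1` [set (f j : nat)]).
have mpre (B : 'I_N -> set nat) : measurable (\bigcap_(j in [set: 'I_N]) (X j @^-1` B j)).
  by apply: fin_bigcap_measurable => // j _; exact: measurable_funPTI.
rewrite (@measure_conull_setI _ (\bigcap_(j in [set: 'I_N]) (X j @^-1` [set m | (m < k)%N])))//; first last.
- by rewrite independent_prefix big1.
- exact: measurable_funPTI.
rewrite [X in P X](_ : _ = \bigcup_(f in [set f | prime_product f \in A]) cell f).
  rewrite measure_fin_bigcup; first last.
  - by move=> f _; exact: mpre.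
  - move=> f g _ _ [t [ft gt]]; apply/ffunP => j; apply: val_inj.
    by rewrite /= -(ft j)// -(gt j).
  - exact: finite_finset.
  rewrite -fsbig_finType; apply: eq_fsbigr => f _.
  exact: independent_prefix.
have cellE f t : cell f t -> random_integer X N t = prime_product f.
  by move=> ft; apply: eq_bigr => j _; rewrite (ft j).
apply/seteqP; split=> [t [At tk]|t [f]].
  pose f := [ffun j : 'I_N => Ordinal (tk j Logic.I)].
  have ft : cell f t by move=> j _; rewrite /= ffunE.
  by exists f => //=; rewrite inE -(cellE _ _ ft).
rewrite /= inE => Af ft; split; first by rewrite /= (cellE _ _ ft).
by move=> j _; rewrite /= (ft j).
Qed.
End independence.

Theorem proposition2 (R : realType) (d : measure_display)
    (T : measurableType d) (P : probability T R) (N k : nat) (hk : (2 <= k)%N)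
    (X : nat -> {RV P >-> nat})
    (X_independent : mutually_independent X)
    (X_law : forall (j : nat) (A : set nat),
      distribution P (X j) A =
      conditioned (geometric_prob (1 - ((nth_prime j)%:R)^-1))
        [set m | (m < k)%N] A) :
  forall A : set nat,
    distribution P (random_integer X N) A =
    conditioned (harmonic_prob N) (k_free k) A.
Proof.
move=> A; have k0 : (0 < k)%N by exact: ltnW.
have x01 j : 0 <= ((nth_prime j)%:R^-1 : R) < 1.
  by have /andP[-> /le_lt_trans ->] := @invr_prime_bounds R j; rewrite ?invf_lt1 ?ltr1n.
rewrite conditioned_harmonic_prob// [LHS](probability_prime_product _ X_independent N k).
  under eq_bigr => f _.
    under eq_bigr => j _.
      rewrite [P _](X_law j [set (f j : nat)]) conditioned_geometric_prob1//.
      over.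
    rewrite prodEFin prodf_div -harmonic_weightT -invr_prime_product.
    over.
  by rewrite sumEFin -mulr_suml.
by move=> j; rewrite [LHS](X_law j) conditioned_geometric_prob_lt.
Qed.
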